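(* Let $\Lambda$ be a compact minimal set of a $C^0$ flow on a generalized Peano continuum $M$. Then, either (1) $\Lambda\in\mathrm{cl}_H\,\mathcal{U}$, or (2) $\Lambda$ is an attractor, or (3) there are arbitrarily small compact, connected, (+)invariant neighbourhoods $U$ of $\Lambda$ in $M$ such that: (a) the (compact) minimal sets contained in $U$ are all Lyapunov hyper-stable and their set $H\mathcal{S}(U)$ is a non-degenerate Peano continuum (in the Hausdorff metric); (b) for each $x\in U$, $\omega(x)\in H\mathcal{S}(U)$, and if $x\notin\omega(x)$, then the negative orbit of $x$ leaves $U$ and never returns again, i.e. there is $T\le 0$ such that $x^t\notin U$ for all $t<T$ and $x^t\in U$ for all $t\ge T$.
   Context: A generalized Peano continuum is a locally compact, connected and locally connected metric space; a Peano continuum is a compact one; non-degenerate means having more than one point. A $C^0$ flow on $M$ is a continuous action of $(\mathbb{R},+)$ on $M$, written $(t,x)\mapsto x^t$; $\omega(x)=\bigcap_{T\ge 0}\overline{\{x^t:t\ge T\}}$. A minimal set is a nonempty closed invariant set containing no smaller nonempty closed invariant set. $\mathrm{CMin}$ is the set of all compact minimal sets of the flow, endowed with the Hausdorff metric $d_H$; $\mathrm{cl}_H$ is closure in $[\mathrm{CMin},d_H]$. A neighbourhood of a set $Y\subset M$ is a set whose interior contains $Y$; ''arbitrarily small neighbourhoods $U$ of $\Lambda$ with property P'' means that every neighbourhood of $\Lambda$ contains a neighbourhood $U$ of $\Lambda$ with property P. A set $V$ is (+)invariant if $x^t\in V$ for all $x\in V$, $t\ge 0$. A nonempty compact invariant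 set $K$ is (Lyapunov) stable if every neighbourhood of $K$ contains a (+)invariant neighbourhood of $K$; otherwise unstable. $\mathcal{U}$ is the set of unstable compact minimal sets. $\Lambda\in\mathrm{CMin}$ is (Lyapunov) hyper-stable if some neighbourhood of $\Lambda$ in $M$ intersects no $\Gamma\in\mathcal{U}$; $H\mathcal{S}(U)$ is the set of hyper-stable compact minimal sets contained in $U$. A nonempty compact invariant set $K$ is an attractor if it is stable and $\{x\in M:\emptyset\ne\omega(x)\subset K\}$ is a neighbourhood of $K$. *)

(* Defs.v *)
From HB Require Import structures.
From mathcomp Require Import all_boot all_order all_algebra.
From mathcomp Require Import all_classical all_reals all_analysis.

Set Implicit Arguments.
Unset Strict Implicit.
Unset Printing Implicit Defensive.

Import Order.TTheory GRing.Theory Num.Theory.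
Import numFieldNormedType.Exports.

Local Open Scope classical_set_scope.
Local Open Scope ring_scope.

(* Local connectedness of [A] in its subspace topology; the relatively open
   subsets of [A] are the sets [W `&` A] with [W] open. *)
Definition locally_connected (T : topologicalType) (A : set T) :=
  forall x, A x -> forall V, nbhs x V ->
  exists W, [/\ open W, W x, W `&` A `<=` V & connected (W `&` A)].

(* Metrizability comes from the type. The library's [locally_compact A] is used
   for the whole space only: on a non-closed [A] it is weaker than local
   compactness of the subspace [A]. *)
Definition generalized_peano_continuum (R : realType) (M : metricType R) :=
  [/\ locally_compact [set: M], connected [set: M] &
      locally_connected [set: M]].

(* Local compactness is implied by compactness. *)
Definition peano_continuum (R : realType) (T : metricType R) (A : set T) :=
  [/\ compact A, connected A & locally_connected A].

Definition non_degenerate (T : Type) (A : set T) :=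
  exists x y, [/\ A x, A y & x <> y].

Record flow (R : realType) (M : metricType R) := Flow {
  flow_fun :> R -> M -> M ;
  flow_continuous : continuous (fun p : R * M => flow_fun p.1 p.2) ;
  flow0 : forall x, flow_fun 0 x = x ;
  flowD : forall s t x, flow_fun (s + t) x = flow_fun s (flow_fun t x)
}.

Section flow_definitions.
Context {R : realType} {M : metricType R} (phi : flow M).
Implicit Types (x : M) (A K U : set M).

Definition invariant A := forall t x, A x -> A (phi t x).

Definition pos_invariant A := forall t x, 0 <= t -> A x -> A (phi t x).

Definition omega x : set M :=
  \bigcap_(T in [set T : R | 0 <= T])
    closure [set phi t x | t in [set t : R | T <= t]].

Definition minimal A :=
  [/\ A !=set0, closed A, invariant A &
      forall B : set M, B !=set0 -> closed B -> invariant B ->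
        B `<=` A -> B = A].

(* The library's [set_nbhs K V] says that the interior of [V] contains [K]. *)
Definition stable K :=
  [/\ K !=set0, compact K, invariant K &
      forall V, set_nbhs K V ->
        exists U, [/\ set_nbhs K U, pos_invariant U & U `<=` V]].

Definition attractor K :=
  stable K /\ set_nbhs K [set x | omega x !=set0 /\ omega x `<=` K].

Record cmin := CMin {
  cmin_set :> set M ;
  cmin_compact : compact cmin_set ;
  cmin_minimal : minimal cmin_set
}.

Definition unstable : set cmin := [set G : cmin | ~ stable G].

Definition hyper_stable (L : cmin) :=
  exists2 N : set M, set_nbhs L N &
    forall G : cmin, unstable G -> G `&` N = set0.

(* The set of hyper-stable compact minimal sets contained in [U]. *)
Definition HS U : set cmin := [set L : cmin | hyper_stable L /\ L `<=` U].

End flow_definitions.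

Arguments unstable {R M} phi.
Arguments HS {R M} phi U.

Section hausdorff_distance.
Context {R : realType} {M : metricType R}.
Implicit Types (A B C : set M) (e : R).

Definition hausdorff_close A B e :=
  [/\ 0 < e, (forall a, A a -> exists2 b, B b & mdist a b < e) &
      (forall b, B b -> exists2 a, A a & mdist a b < e)].

(* The Hausdorff metric when restricted to nonempty compact sets; [inf] is
   meaningful there because some [e] always qualifies. *)
Definition hausdorff_dist A B : R := inf [set e | hausdorff_close A B e].

Lemma hausdorff_close_lb A B : has_lbound [set e | hausdorff_close A B e].
Proof. by exists 0 => e [/ltW]. Qed.

Lemma compact_mdist_lt A (x : M) : compact A ->
  exists2 r : R, 0 < r & forall a, A a -> mdist x a < r.
Proof.
move=> /compact_near_coveringP cA.
have /cA : forall y, A y ->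
    \forall y' \near y & r \near (+oo : set_system R), mdist x y' < r.
  move=> y Ay; exists (ball y 1, [set r | mdist x y + 1 < r]).
    split; first exact: nbhsx_ballx.
    exists (mdist x y + 1); split => //; exact: num_real.
  move=> [y' r] [/=]; rewrite ballEmdist /= => yy' rgt.
  apply: le_lt_trans rgt; apply: (le_trans (metric_triangle x y y')).
  by rewrite lerD2l ltW.
move=> Alt.
have [r [r0 rA]] : exists r : R, 0 < r /\ A `<=` (fun a => mdist x a < r).
  near (+oo : set_system R) => r.
  exists r; split; first by near: r; exact: nbhs_pinfty_gt.
  by near: r; exact: Alt.
by exists r.
Unshelve. all: by end_near. Qed.

Lemma hausdorff_close_ex A B : A !=set0 -> B !=set0 ->
  compact A -> compact B -> exists e, hausdorff_close A B e.
Proof.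
move=> [a Aa] [b Bb] cA cB.
have [r r0 rA] := compact_mdist_lt b cA.
have [s s0 sB] := compact_mdist_lt a cB.
exists (r + s); split; first exact: addr_gt0.
  move=> x Ax; exists b => //; rewrite metric_sym.
  by rewrite (lt_trans (rA _ Ax))// ltrDl.
by move=> x Bx; exists a => //; rewrite (lt_trans (sB _ Bx))// ltrDr.
Qed.

Lemma hausdorff_close_sym A B e :
  hausdorff_close A B e -> hausdorff_close B A e.
Proof.
move=> [e0 h1 h2]; split => // x Hx.
  by have [y ? ?] := h2 _ Hx; exists y => //; rewrite metric_sym.
by have [y ? ?] := h1 _ Hx; exists y => //; rewrite metric_sym.
Qed.

Lemma hausdorff_close_trans A B C e f : hausdorff_close A B e ->
  hausdorff_close B C f -> hausdorff_close A C (e + f).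
Proof.
move=> [e0 h1 h2] [f0 k1 k2]; split; first exact: addr_gt0.
  move=> a /h1[b /k1[c Cc bc] ab]; exists c => //.
  by rewrite (le_lt_trans (metric_triangle a b c))// ltrD.
move=> c /k2[b /h2[a Aa ab] bc]; exists a => //.
by rewrite (le_lt_trans (metric_triangle a b c))// ltrD.
Qed.

Lemma hausdorff_distxx A : hausdorff_dist A A = 0.
Proof.
have cl e : 0 < e -> hausdorff_close A A e.
  by move=> e0; split=> // x Ax; exists x => //; rewrite mdistxx.
apply/eqP; rewrite eq_le; apply/andP; split.
  apply/ler_addgt0Pl => e e0; rewrite addr0.
  by apply: ge_inf; [exact: hausdorff_close_lb|exact: cl].
by apply: lb_le_inf; [exists 1; exact: cl|move=> e [/ltW]].
Qed.

Lemma hausdorff_dist_sym A B : hausdorff_dist A B = hausdorff_dist B A.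
Proof.
by congr inf; apply/seteqP; split => e /=; exact: hausdorff_close_sym.
Qed.

Lemma hausdorff_dist_lt A B e : A !=set0 -> B !=set0 ->
  compact A -> compact B -> hausdorff_dist A B < e -> hausdorff_close A B e.
Proof.
move=> A0 B0 cA cB dlt.
have hi : [set e | hausdorff_close A B e] !=set0 by exact: hausdorff_close_ex.
have [f [f0 h1 h2] fe] := inf_lt hi dlt.
split; first exact: lt_trans fe.
  by move=> a /h1[b Bb ab]; exists b => //; exact: lt_trans fe.
by move=> b /h2[a Aa ab]; exists a => //; exact: lt_trans fe.
Qed.

Lemma hausdorff_dist_eq0 A B : A !=set0 -> B !=set0 ->
  compact A -> compact B -> hausdorff_dist A B = 0 -> A = B.
Proof.
move=> A0 B0 cA cB d0.
have cl e : 0 < e -> hausdorff_close A B e.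
  by move=> e0; apply: hausdorff_dist_lt => //; rewrite d0.
have clA := compact_closed (@metric_hausdorff _ M) cA.
have clB := compact_closed (@metric_hausdorff _ M) cB.
apply/seteqP; split => x Hx; [apply: clB|apply: clA] => V /nbhs_ballP[e e0 eV].
  have [_ h _] := cl _ e0; have [y By xy] := h _ Hx.
  by exists y; split => //; apply: eV; rewrite ballEmdist.
have [_ _ h] := cl _ e0; have [y By xy] := h _ Hx.
by exists y; split => //; apply: eV; rewrite ballEmdist /= metric_sym.
Qed.

Lemma hausdorff_dist_triangle B A C : A !=set0 -> B !=set0 -> C !=set0 ->
  compact A -> compact B -> compact C ->
  hausdorff_dist A C <= hausdorff_dist A B + hausdorff_dist B C.
Proof.
move=> A0 B0 C0 cA cB cC; apply/ler_addgt0Pr => e e0.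
rewrite [e in leRHS]splitr addrACA; apply: ge_inf.
  exact: hausdorff_close_lb.
by apply: (@hausdorff_close_trans _ B); apply: hausdorff_dist_lt => //;
  rewrite ltrDl divr_gt0.
Qed.

End hausdorff_distance.

Section cmin_metric.
Context {R : realType} {M : metricType R} (phi : flow M).

Lemma cmin_nonempty (L : cmin phi) : (L : set M) !=set0.
Proof. by have [] := cmin_minimal L. Qed.

Lemma cmin_set_inj : injective (@cmin_set R M phi).
Proof.
move=> [A cA mA] [B cB mB] /= AB; subst B.
by congr CMin; exact: Prop_irrelevance.
Qed.

HB.instance Definition _ := gen_eqMixin (cmin phi).
HB.instance Definition _ := gen_choiceMixin (cmin phi).

Let dist (L G : cmin phi) : R := hausdorff_dist L G.

Let distxx L : dist L L = 0. Proof. exact: hausdorff_distxx. Qed.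

Let dist_eq0 L G : dist L G = 0 -> L = G.
Proof.
by move=> d0; apply: cmin_set_inj; apply: hausdorff_dist_eq0 d0;
  (exact: cmin_nonempty || exact: cmin_compact).
Qed.

Let dist_sym L G : dist L G = dist G L. Proof. exact: hausdorff_dist_sym. Qed.

Let dist_triangle G L H : dist L H <= dist L G + dist G H.
Proof.
by apply: hausdorff_dist_triangle;
  (exact: cmin_nonempty || exact: cmin_compact).
Qed.

HB.instance Definition _ := isMetric.Build R (cmin phi)
  distxx dist_eq0 dist_sym dist_triangle.

Lemma cmin_mdistE (L G : cmin phi) : mdist L G = hausdorff_dist L G.
Proof. by []. Qed.

End cmin_metric.

(* Main.v *)
Require Import Defs.
From mathcomp Require Import all_boot all_order all_algebra.
From mathcomp Require Import all_classical all_reals all_analysis.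
From mathcomp Require Import lra.

(** Suppose that [L] is neither a limit of unstable minimal sets nor an
    attractor.

    Minimal sets that meet a small neighbourhood of [L] are close to [L] for the
    Hausdorff metric: [L] is stable, hence they stay near [L], and an orbit near
    [L] follows the dense orbits of [L] ([stable_omega_near]). So some
    neighbourhood of [L] meets no unstable minimal set, and it contains a
    compact positively invariant neighbourhood [W] of [L] whose minimal sets are
    all hyper-stable ([hyper_stable_notin_closure], [stable_trap]). A limit set
    in [W] contains a minimal set, which is stable and therefore traps the
    orbit: each point of [W] converges to a single minimal set
    ([omega_stable_cmin]). Likewise a point whose whole orbit stays in [W]
    belongs to a minimal set, found in its backward limit set
    ([complete_orbit_recurrent]); this yields the exit time of the other points.

    The map sending a point of [W] to its limit set is thus defined, and it is
    continuous for the Hausdorff metric ([limit_cmin_continuous]). For any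
    connected neighbourhood [S] of [L] in [W], let [U] be the closure of the
    positive orbit of [S]. As the limit map is constant along orbits, the
    minimal sets in [U] are the images of the points of [closure S]
    ([HS_closure_pos_orbit]). They form a compact connected set, which has more
    than one point because [L] is not an attractor. It remains to choose [S] so
    that this image is locally connected.

    Local connectedness of [S] is not enough, since [closure S] may fail to be
    locally connected. The right notion is property S: being a finite union of
    connected sets of arbitrarily small diameter. It passes to [closure S]
    ([property_S_closure]) and then to the image ([property_S_image]), where it
    implies local connectedness ([property_S_locally_connected]). Neighbourhoods
    with property S exist in every locally connected space where [L] has a
    compact neighbourhood: take the points reached from [L] by chains of
    connected sets whose diameters decrease geometrically
    ([property_S_set_nbhs]). *)

Set Implicit Arguments.
Unset Strict Implicit.
Unset Printing Implicit Defensive.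

Import Order.TTheory GRing.Theory Num.Theory.
Import numFieldNormedType.Exports.

Local Open Scope classical_set_scope.
Local Open Scope ring_scope.

(** * Compact sets in metric spaces *)

Section metric_spaces.
Context {R : realType} {T : metricType R}.
Implicit Types (A B K V X : set T) (e : R).

Definition thickening A e : set T := [set x | exists2 a, A a & mdist a x < e].

Lemma nbhs_mdistP (x : T) V :
  nbhs x V <-> exists2 e, 0 < e & forall y, mdist x y < e -> V y.
Proof.
split=> [/nbhs_ballP[e e0 eV]|[e e0 eV]].
  by exists e => // y xy; apply: eV; rewrite ballEmdist.
by apply/nbhs_ballP; exists e => // y; rewrite ballEmdist => /eV.
Qed.

Lemma nbhs_mdist_lt (x : T) e : 0 < e -> nbhs x [set y | mdist x y < e].
Proof. by move=> e0; apply/nbhs_mdistP; exists e. Qed.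

Lemma mdist_lt_nbhs (x y : T) e :
  mdist x y < e -> nbhs y [set z | mdist x z < e].
Proof.
move=> xy; apply/nbhs_mdistP; exists (e - mdist x y); rewrite ?subr_gt0//.
move=> z yz; rewrite /= (le_lt_trans (metric_triangle x y z))//.
by rewrite -ltrBrDl.
Qed.

Lemma mdist_lt_split (y x z : T) e :
  mdist x y < e / 2 -> mdist y z < e / 2 -> mdist x z < e.
Proof.
move=> xy yz; rewrite (le_lt_trans (metric_triangle x y z))//.
by rewrite [e in ltRHS]splitr ltrD.
Qed.

Lemma closure_mdistP A (x : T) :
  closure A x <-> forall e, 0 < e -> exists2 a, A a & mdist x a < e.
Proof.
split=> [Ax e /(nbhs_mdist_lt x)/Ax[a [Aa xa]]|H V /nbhs_mdistP[e e0 eV]].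
  by exists a.
by have [a Aa /eV Va] := H _ e0; exists a.
Qed.

Lemma set_nbhs_thickening A e : 0 < e -> set_nbhs A (thickening A e).
Proof.
move=> e0 a Aa; apply/nbhs_mdistP; exists e => // y ay.
by exists a.
Qed.

Lemma closure_thickening A e :
  0 < e -> closure (thickening A (e / 2)) `<=` thickening A e.
Proof.
move=> e0 x /closure_mdistP/(_ (e / 2)); rewrite divr_gt0// => /(_ isT).
move=> [y [a Aa ay] xy]; exists a => //; apply: mdist_lt_split ay _.
by rewrite metric_sym.
Qed.

Lemma closed_thickening A : closed A ->
  \bigcap_(e in [set e | 0 < e]) thickening A e `<=` A.
Proof.
move=> cA x Hx; apply: cA; apply/closure_mdistP => e e0.
by have [a Aa ax] := Hx _ e0; exists a => //; rewrite metric_sym.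
Qed.

Lemma compact_closed_set K : compact K -> closed K.
Proof. exact: (compact_closed (@metric_hausdorff _ T)). Qed.

Lemma compact_thickening_sub K V : compact K -> set_nbhs K V ->
  exists2 e, 0 < e & thickening K e `<=` V.
Proof.
move=> /compact_near_coveringP cK KV.
have /cK Ke : forall x, K x -> \forall x' \near x & e \near (0:R)^'+,
    thickening [set x'] e `<=` V.
  move=> x /KV/nbhs_mdistP[e e0 eV].
  exists ([set y | mdist x y < e / 2], [set d : R | d < e / 2]).
    split; first by apply: nbhs_mdist_lt; rewrite divr_gt0.
    by apply: nbhs_right_lt; rewrite divr_gt0.
  move=> [y d] [/= xy de] z [_ -> yz]; apply: eV.
  exact: mdist_lt_split xy (lt_trans yz de).
have [e [e0 eV]] : exists e,
    0 < e /\ forall x, K x -> thickening [set x] e `<=` V.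
  near (0:R)^'+ => e; exists e; split.
    by near: e; exact: nbhs_right_gt.
  by near: e; exact: Ke.
by exists e => // y [x Kx xy]; apply: (eV x) => //; exists x.
Unshelve. all: by end_near. Qed.

(** The near-covering property is used along the filter of all large enough
    finite subsets of [K]. *)
Lemma compact_finite_cover K (O : T -> set T) : compact K ->
  (forall x, K x -> nbhs x (O x)) ->
  exists D : set T, [/\ finite_set D, D `<=` K & K `<=` \bigcup_(x in D) O x].
Proof.
move=> /compact_near_coveringP cK KO.
pose F := [set Q : set (set T) | exists2 D0, finite_set D0 /\ D0 `<=` K &
  forall D, finite_set D /\ D `<=` K -> D0 `<=` D -> Q D].
have FF : Filter F.
  split; first by exists set0 => //; split => //; exact: finite_set0.
    move=> P Q [D1 [f1 s1] h1] [D2 [f2 s2] h2]; exists (D1 `|` D2).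
      by rewrite finite_setU subUset.
    by move=> D fD; rewrite subUset => -[D1D D2D]; split; [exact: h1|exact: h2].
  by move=> P Q PQ [D fD hD]; exists D => // E fE DE; apply: PQ; exact: hD.
have [|D0 fD0 H] := cK _ F (fun D y => exists2 x, D x & O x y) FF.
  move=> x Kx; exists (O x, [set D : set T | D x]).
    split; first exact: KO.
    exists [set x]; first by split; [exact: finite_set1|move=> _ ->].
    by move=> D _; apply.
  by move=> [y D] [/= Oy Dx]; exists x.
by exists D0; case: fD0 => fD0 sD0; split=> //; exact: H.
Qed.

Lemma locally_compact_set_nbhs K : locally_compact [set: T] -> compact K ->
  exists N, [/\ compact N, closed N & set_nbhs K N].
Proof.
move=> lc cK.
have /choice[W HW] : forall x : T, exists U,
    [/\ nbhs x U, compact U & closed U].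
  move=> x; have [U] := lc x I.
  move=> xU [cU clU]; exists U; split => //.
  have : nbhs x [set y | [set: T] y -> U y] := xU.
  by apply: filterS => y; exact.
have [|D [fD _ KD]] := @compact_finite_cover K (fun x => (W x)°) cK.
  by move=> x _; apply: nbhs_interior; have [] := HW x.
exists (\bigcup_(x in D) W x); split.
- have /finite_fsetP[D' ->] := fD; rewrite -bigsetU_fset_set// set_fsetK.
  by apply: bigsetU_compact => x _; have [] := HW x.
- by apply: closed_bigcup => // x _; have [] := HW x.
- move=> y /KD[x Dx Oxy]; apply: filterS Oxy => z Oz; exact: bigcup_sup Oz.
Qed.

End metric_spaces.

Lemma compact_uniform_continuity {R : realType} {T N : metricType R}
    (K : set T) (f : T -> N) (e : R) :
  compact K -> {within K, continuous f} -> 0 < e -> exists2 d, 0 < d &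
  forall x y, K x -> K y -> mdist x y < d -> mdist (f x) (f y) < e.
Proof.
move=> /compact_near_coveringP/near_covering_withinP cK.
move=> /subspace_continuousP fc e0.
have /cK Kd : forall x, K x -> \forall x' \near x & d \near (0:R)^'+,
    K x' -> forall y, K y -> mdist x' y < d -> mdist (f x') (f y) < e.
  move=> x Kx.
  have e2 : 0 < e / 2 by rewrite divr_gt0.
  have /nbhs_mdistP[r r0 rf] :
      nbhs x [set y | K y -> mdist (f x) (f y) < e / 2].
    have := fc x Kx _ (nbhs_mdist_lt (f x) e2).
    by rewrite nbhs_simpl.
  exists ([set y | mdist x y < r / 2], [set d : R | d < r / 2]).
    split; first by apply: nbhs_mdist_lt; rewrite divr_gt0.
    by apply: nbhs_right_lt; rewrite divr_gt0.
  move=> [x' d] [/= xx' dr] Kx' y Ky x'y.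
  have xr : mdist x x' < r.
    by rewrite (lt_le_trans xx')// ger_pMr// invf_le1 ?ler1n.
  apply: (@le_lt_trans _ _ _ _ _ (metric_triangle _ (f x) _)).
  rewrite [ltRHS]splitr ltrD//.
    by rewrite metric_sym; exact: rf.
  by apply: rf => //; exact: mdist_lt_split xx' (lt_trans x'y dr).
near (0:R)^'+ => d; exists d.
  by near: d; exact: nbhs_right_gt.
move=> x y Kx Ky; move: x Kx y Ky.
suff : K `<=` (fun x => forall y, K y ->
    mdist x y < d -> mdist (f x) (f y) < e).
  by move=> H x Kx y Ky; exact: H.
by near: d; exact: Kd.
Unshelve. all: by end_near. Qed.

(** * Property S *)

Section property_S.
Context {R : realType}.

(** A uniform form of local connectedness, due to Sierpinski. It passes to
    closures, which local connectedness does not, and to continuous images of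
    compact sets; on closed sets it implies local connectedness. *)
Definition property_S (T : metricType R) (X : set T) :=
  forall e : R, 0 < e -> exists D : set (set T),
    [/\ finite_set D, X = \bigcup_(C in D) C, forall C, D C -> connected C &
        forall C, D C -> forall x y, C x -> C y -> mdist x y < e].

Lemma property_S_closed_pieces (T : metricType R) (X : set T) (e : R) :
  property_S X -> 0 < e -> exists D : set (set T),
    [/\ finite_set D, closure X = \bigcup_(C in D) C,
        forall C, D C -> closed C, forall C, D C -> connected C &
        forall C, D C -> forall x y, C x -> C y -> mdist x y < e].
Proof.
move=> SX e0; have e3 : 0 < e / 3 by rewrite divr_gt0.
have [D [fD XD cD dD]] := SX _ e3; exists (closure @` D); split.
- exact: finite_image.
- apply/seteqP; split.
    have cl : closed (\bigcup_(C in D) closure C).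
      by apply: closed_bigcup => // C _; exact: closed_closure.
    rewrite [X in _ `<=` X](_ : _ = \bigcup_(C in D) closure C); last first.
      by rewrite bigcup_image.
    rewrite [X in _ `<=` X]((closure_id _).1 cl) {1}XD; apply: closureS.
    by apply: subset_bigcup => C _; exact: subset_closure.
  by rewrite bigcup_image XD => x [C DC] /closureS; apply; exact: bigcup_sup.
- by move=> _ [C DC <-]; exact: closed_closure.
- by move=> _ [C DC <-]; exact/connected_closure/cD.
- move=> _ [C DC <-] x y /closure_mdistP/(_ _ e3)[x' Cx' xx'].
  move=> /closure_mdistP/(_ _ e3)[y' Cy' yy'].
  have x'y' := dD _ DC _ _ Cx' Cy'.
  have := metric_triangle x x' y; have := metric_triangle x' y' y.
  rewrite [mdist y' y]metric_sym; lra.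
Qed.

Lemma property_S_closure (T : metricType R) (X : set T) :
  property_S X -> property_S (closure X).
Proof.
move=> SX e e0; have [D [fD XD _ cD dD]] := property_S_closed_pieces SX e0.
by exists D.
Qed.

Lemma property_S_image (T N : metricType R) (K : set T) (f : T -> N) :
  compact K -> {within K, continuous f} -> property_S K -> property_S (f @` K).
Proof.
move=> cK fc SK e e0.
have [d d0 fd] := compact_uniform_continuity cK fc e0.
have [D [fD KD cD dD]] := SK _ d0.
have DK C : D C -> C `<=` K by move=> DC; rewrite KD; exact: bigcup_sup.
exists ((fun C => f @` C) @` D); split.
- exact: finite_image.
- by rewrite bigcup_image KD image_bigcup.
- move=> _ [C DC <-]; apply: connected_continuous_connected; first exact: cD.
  by apply: continuous_subspaceW fc; exact: DK.
- move=> _ [C DC <-] _ _ [x Cx <-] [y Cy <-]; apply: fd => //.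
  + exact: DK Cx.
  + exact: DK Cy.
  + exact: dD Cx Cy.
Qed.

(** The closed pieces through a point [x] form a connected neighbourhood of [x]
    in [X], because the finitely many other pieces stay away from [x]. Hence
    the components of relatively open sets are relatively open. *)
Lemma property_S_locally_connected (T : metricType R) (X : set T) :
  closed X -> property_S X -> locally_connected X.
Proof.
move=> clX SX.
have im x V : X x -> nbhs x V -> exists W A : set T,
    [/\ open W, W x, X `&` W `<=` A, connected A & A x /\ A `<=` X `&` V].
  move=> Xx /nbhs_mdistP[e e0 eV].
  have [D [fD XD clD cD dD]] := property_S_closed_pieces SX e0.
  rewrite -((closure_id X).1 clX) in XD.
  exists (~` \bigcup_(C in D `&` [set C | ~ C x]) C).
  exists (\bigcup_(C in D `&` [set C | C x]) C); split.
  - apply: closed_openC; apply: closed_bigcup; last by move=> C [/clD].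
    by apply: sub_finite_set fD; exact: subIsetl.
  - by move=> [C [_ /= nCx]].
  - move=> y []; rewrite {1}XD => -[C DC Cy] nC; exists C => //; split=> //=.
    by apply: contrapT => nCx; apply: nC; exists C.
  - by apply: bigcup_connected; [exists x => C []|move=> C [/cD]].
  - split; first by move: (Xx); rewrite {1}XD => -[C DC Cx]; exists C.
    move=> y [C [DC /= Cx] Cy]; split; first by rewrite XD; exists C.
    by apply: eV; exact: dD Cx Cy.
move=> x Xx V; rewrite nbhsE => -[V' [oV' V'x] V'V].
pose C := connected_component (X `&` V') x.
have CXV : C `<=` X `&` V' by exact: connected_component_sub.
pose F := [set O : set T | open O /\ X `&` O `<=` C].
have WX : \bigcup_(O in F) O `&` X = C.
  apply/seteqP; split=> [y [[Q [_ QC] Qy] Xy]|y Cy]; first exact: QC.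
  have [Xy V'y] := CXV _ Cy.
  have [W [A [oW Wy WA cA [Ay AV]]]] :=
    im _ V' Xy (open_nbhs_nbhs (conj oV' V'y)).
  split => //; exists W => //; split=> // z /WA Az.
  apply: (connected_component_trans Cy).
  exact: connected_component_max Az.
have Cx : C x by exact: connected_component_refl.
exists (\bigcup_(O in F) O); split.
- by apply: bigcup_open => O [].
- by move: Cx; rewrite -WX => -[].
- by rewrite WX => y /CXV[_ /V'V].
- by rewrite WX; exact: component_connected.
Qed.

End property_S.

(** * Neighbourhoods with property S *)

Section chains.
Context {R : realType} {T : metricType R}.
Implicit Types (x y z p : T) (k : nat).

(** Chains of connected links whose sizes halve at each step. Since the sizes
    are summable, a chain that starts with a late link stays close to its
    origin; this is what makes the set of the points reached from a given set
    have property S, which a mere neighbourhood need not have. *)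
Inductive reach (r : R) : nat -> T -> T -> Prop :=
| reach_refl k x : reach r k x x
| reach_link k x C y z : connected C -> C x -> C y ->
    C `<=` ball x (r / 2 ^+ k) -> reach r k.+1 y z -> reach r k x z.

Lemma reachS r k x y : 0 < r -> reach r k.+1 x y -> reach r k x y.
Proof.
move=> r0; apply: (@reach_link _ k x [set x]) => //; first exact: connected1.
by move=> _ ->; apply: ballxx; rewrite divr_gt0// exprn_gt0.
Qed.

Lemma reach_dist r k x y : 0 < r -> reach r k x y ->
  mdist x y < 2 * (r / 2 ^+ k).
Proof.
move=> r0; elim=> {k x y} [k x|k x C y z cC Cx Cy Cb _ IH].
  by rewrite mdistxx mulr_gt0// divr_gt0// exprn_gt0.
have := Cb _ Cy; rewrite ballEmdist /= => xy.
have := metric_triangle x y z.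
have : r / 2 ^+ k.+1 = r / 2 ^+ k / 2 by rewrite exprSr invfM mulrA.
lra.
Qed.

Lemma reach_connected r k x : connected (reach r k x).
Proof.
have H y : reach r k x y ->
    exists D, [/\ connected D, D x, D y & D `<=` reach r k x].
  elim=> {k x y} [k x|k x C y z cC Cx Cy Cb _ [D [cD Dy Dz Dr]]].
    exists [set x]; split => //; first exact: connected1.
    by move=> _ ->; exact: reach_refl.
  exists (C `|` D); split; [|by left|by right|].
    by apply: connectedU => //; exists y.
  move=> w [Cw|/Dr yw]; first exact: reach_link cC Cx Cw Cb (reach_refl _ _ _).
  exact: reach_link cC Cx Cy Cb yw.
rewrite (_ : reach r k x = \bigcup_(D in
    [set D | [/\ connected D, D x & D `<=` reach r k x]]) D).
  by apply: bigcup_connected; [exists x => D []|move=> D []].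
apply/seteqP; split=> y; first by move=> /H[D [? ? ? ?]]; exists D.
by move=> [D [_ _ +] Dy]; apply.
Qed.

Lemma reach_nbhs r k x : locally_connected [set: T] -> 0 < r ->
  nbhs x (reach r k x).
Proof.
move=> lc r0.
have rk : 0 < r / 2 ^+ k by rewrite divr_gt0// exprn_gt0.
have [W [oW Wx]] := lc x I _ (nbhsx_ballx x _ rk).
rewrite setIT => Wb cW.
apply: (@filterS _ _ _ W); last exact: open_nbhs_nbhs.
by move=> y Wy; exact: reach_link cW Wx Wy Wb (reach_refl _ _ _).
Qed.

(** Cut a chain before its link of index [k], at a point [p] say: every chain
    of index [k] issued from [p] can replace the part that was cut off, so it
    also stays in [S]. *)
Lemma reach_split r k (S : set T) l y : 0 < r ->
  reach r 0 l `<=` S -> reach r 0 l y ->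
  exists2 p, reach r k p `<=` S & reach r k p y.
Proof.
move=> r0 lS ly; elim: k => [|k [p pS py]]; first by exists l.
move: pS; inversion py as [|? ? C q ? cC Cp Cq Cb qy]; subst => pS.
  by exists y; [move=> z /(reachS r0)/pS|exact: reach_refl].
exists q => // z qz; apply: pS; exact: reach_link cC Cp Cq Cb qz.
Qed.

(** Let [S] be the set of the points reached from [A], and fix a large [k]. The
    points [p] whose chains of index [k] stay in [S] are grouped according to a
    finite cover by connected open sets that are small compared to
    [r / 2 ^+ k]; a group gives rise to the set of all points reached by chains
    of index [k] from its members. These sets are small, and [reach_split] says
    that they cover [S]. They are connected because the covering set of a group
    can serve as a first link from each of its members. *)
Lemma property_S_reach r (A K : set T) : locally_connected [set: T] ->
  compact K -> 0 < r ->
  \bigcup_(l in A) reach r 0 l `<=` K ->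
  property_S (\bigcup_(l in A) reach r 0 l).
Proof.
set S := \bigcup_(l in A) _ => lc cK r0 SK e e0.
have [k ke] : exists k, 5 * (r / 2 ^+ k) < e.
  exists (Num.bound (5 * r / e)); rewrite mulrA ltr_pdivrMr ?exprn_gt0//.
  by rewrite -ltr_pdivrMl// mulrC upper_nthrootP.
have rk : 0 < r / 2 ^+ k by rewrite divr_gt0// exprn_gt0.
have /choice[Q HQ] : forall z : T, exists Q, [/\ nbhs z Q, connected Q, Q z &
    Q `<=` ball z (r / 2 ^+ k / 2)].
  move=> z; have rk2 : 0 < r / 2 ^+ k / 2 by rewrite divr_gt0.
  have [W [oW Wz]] := lc z I _ (nbhsx_ballx z _ rk2).
  by rewrite setIT => Wb cW; exists W; split => //; exact: open_nbhs_nbhs.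
have [|D [fD _ KD]] := @compact_finite_cover _ _ K Q cK.
  by move=> x _; have [] := HQ x.
pose P z := Q z `&` [set p | reach r k p `<=` S].
pose G z := \bigcup_(p in P z) reach r k p.
have PQ z p : P z p -> Q z `<=` reach r k p.
  move=> [Qp _] q Qq; have [_ cQ _ Qb] := HQ z.
  apply: (reach_link cQ Qp Qq _ (reach_refl _ _ _)) => w Qw.
  rewrite [r / _]splitr.
  exact: ball_triangle (ball_sym (Qb _ Qp)) (Qb _ Qw).
have Gz z x : G z x -> mdist z x < e / 2.
  move=> [p [Qp pS] px]; have [_ _ _ /(_ _ Qp)] := HQ z.
  rewrite ballEmdist /= => zp; have := reach_dist r0 px.
  have := metric_triangle z p x; lra.
exists (G @` D); split.
- exact: finite_image.
- rewrite bigcup_image; apply/seteqP; split=> y; last first.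
    by move=> [z _ [p [_ pS] py]]; exact: pS.
  move=> [l Al ly]; have lS : reach r 0 l `<=` S by exact: bigcup_sup.
  have [p pS py] := reach_split k r0 lS ly.
  have /KD[z Dz Qp] : K p by apply/SK/pS; exact: reach_refl.
  by exists z => //; exists p.
- move=> _ [z _ <-]; apply: bigcup_connected; last first.
    by move=> p _; apply: reach_connected.
  by exists z => p Pp; apply: (PQ z p) => //; have [] := HQ z.
- move=> _ [z _ <-] x y /Gz zx /Gz zy; apply: (mdist_lt_split (y := z)) zy.
  by rewrite metric_sym.
Qed.

(** If [N] contains the [e]-thickening of [A], it contains the points reached
    from [A] by chains whose sizes have total [e]. *)
Lemma property_S_set_nbhs (A N : set T) : locally_connected [set: T] ->
  compact A -> connected A -> A !=set0 -> compact N -> set_nbhs A N ->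
  exists S, [/\ set_nbhs A S, S `<=` N, connected S & property_S S].
Proof.
move=> lc cA ctA [a Aa] cN AN.
have [e e0 eN] := compact_thickening_sub cA AN.
have r0 : 0 < e / 2 by rewrite divr_gt0.
pose S := \bigcup_(l in A) reach (e / 2) 0 l.
have SN : S `<=` N.
  move=> y [l Al /(reach_dist r0)]; rewrite expr0 divr1 mulrC divfK// => ly.
  by apply: eN; exists l.
exists S; split=> //.
- move=> l Al; apply: filterS (reach_nbhs 0 l lc r0); exact: bigcup_sup.
- have -> : S = \bigcup_(l in A) (A `|` reach (e / 2) 0 l).
    apply/seteqP; split=> y [l Al]; first by exists l => //; right.
    by move=> [Ay|ly]; [exists y => //; exact: reach_refl|exists l].
  apply: bigcup_connected; first by exists a => l _; left.
  move=> l Al; apply: connectedU => //; last exact: reach_connected.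
  by exists l; split => //; exact: reach_refl.
- exact: property_S_reach SN.
Qed.

End chains.

(** * Limit sets and minimal sets *)

Section limit_sets.
Context {R : realType} {M : metricType R} (phi : flow M).
Implicit Types (x y : M) (A K U V W : set M) (t : R) (G H : cmin phi).

Lemma flow_time_continuous t : continuous (phi t).
Proof.
move=> x; apply: (@continuous_comp _ _ _ (fun y => (t, y))
  (fun p : R * M => phi p.1 p.2)); last exact: flow_continuous.
exact: (cvg_pair (cvg_cst t) cvg_id).
Qed.

Lemma flow_orbit_continuous x : continuous (phi^~ x).
Proof.
move=> t; apply: (@continuous_comp _ _ _ (fun s => (s, x))
  (fun p : R * M => phi p.1 p.2)); last exact: flow_continuous.
exact: (cvg_pair cvg_id (cvg_cst x)).
Qed.

Lemma closure_pos_invariant A : pos_invariant phi A ->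
  pos_invariant phi (closure A).
Proof.
move=> iA t x t0 Ax B /flow_time_continuous/Ax[y [Ay By]].
by exists (phi t y); split => //; exact: iA.
Qed.

Lemma closure_invariant A :
  Defs.invariant phi A -> Defs.invariant phi (closure A).
Proof.
move=> iA t x Ax B /flow_time_continuous/Ax[y [Ay By]].
by exists (phi t y); split => //; exact: iA.
Qed.

Lemma omegaP x y : omega phi x y <->
  forall T B, nbhs y B -> exists2 t, T <= t & B (phi t x).
Proof.
split=> [xy T B yB|H T _ B yB]; last first.
  by have [t Tt Bt] := H T _ yB; exists (phi t x); split => //; exists t.
have [|_ [[t /= Tt <-] Bt]] := xy (Num.max T 0) _ _ yB.
  by rewrite /= le_max lexx orbT.
by exists t => //; move: Tt; rewrite ge_max => /andP[].
Qed.

Lemma omega_closed x : closed (omega phi x).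
Proof. by apply: closed_bigI => T _; exact: closed_closure. Qed.

Lemma omega_invariant x : Defs.invariant phi (omega phi x).
Proof.
move=> s y /omegaP xy; apply/omegaP => T B /flow_time_continuous.
move=> /(xy (T - s))[t Tt Bt]; exists (s + t); first by rewrite -lerBlDl.
by rewrite flowD.
Qed.

Lemma omega_shift s x : omega phi (phi s x) = omega phi x.
Proof.
apply/seteqP; split=> y /omegaP xy; apply/omegaP => T B yB.
  have [t Tt Bt] := xy (T - s) _ yB; exists (t + s); first by rewrite -lerBlDr.
  by rewrite flowD.
have [t Tt Bt] := xy (T + s) _ yB; exists (t - s); first by rewrite lerBrDr.
by rewrite -flowD subrK.
Qed.

Lemma omega_sub x A : closed A -> pos_invariant phi A ->
  (exists t, A (phi t x)) -> omega phi x `<=` A.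
Proof.
move=> cA iA [s As] y /omegaP xy; apply: cA => B yB.
have [t st Bt] := xy s _ yB; exists (phi t x); split => //.
by rewrite -(subrK s t) flowD; apply: iA; rewrite ?subr_ge0.
Qed.

Lemma omega_nonempty x K : compact K -> pos_invariant phi K -> K x ->
  omega phi x !=set0.
Proof.
move=> cK iK Kx.
have [|y [_ xy]] := cK (phi^~ x @ +oo) _.
  by exists 0; split => // t /ltW t0; exact: iK.
exists y; apply/omegaP => T B yB.
have [|_ [[t Tt <-] Bt]] := xy [set phi t x | t in [set t | T < t]] _ _ yB.
  by exists T; split; [exact: num_real|move=> t Tt; exists t].
by exists t => //; exact: ltW.
Qed.

Lemma compact_invariant_cmin K :
  compact K -> Defs.invariant phi K -> K !=set0 -> exists G, G `<=` K.
Proof.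
move=> cK iK [x0 Kx0]; have clK := compact_closed_set cK.
pose P X :=
  [/\ K `\` X !=set0, closed (K `\` X) & Defs.invariant phi (K `\` X)].
(* The maximal element of Zorn's lemma is the complement of the minimal set. *)
have [F FP Ftot|X [[X0 clX iX] Xmax]] := @Zorn_bigcup _ P.
  rewrite /P.
  have -> : K `\` \bigcup_(X in F) X = K `&` \bigcap_(X in F) (K `\` X).
    apply/seteqP; split=> [x [Kx nx]|x [Kx nx]]; split => //.
      by move=> X FX; split => // Xx; apply: nx; exists X.
    by move=> [X FX Xx]; have [] := nx _ FX.
  split; last 1 first.
  - move=> t x [Kx Fx]; split; first exact: iK.
    by move=> X FX; have [_ _] := FP _ FX; apply; exact: Fx.
  - have [[X1 FX1]|F0] := pselect (F !=set0); last first.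
      by exists x0; split => // X FX; case: F0; exists X.
    pose B := filter_from F (fun X => K `\` X).
    have BF : ProperFilter B.
      apply: filter_from_proper; last by move=> X /FP[].
      apply: filter_from_filter; first by exists X1.
      move=> X Y FX FY.
      have [XY|YX] := Ftot _ _ FX FY; [exists Y|exists X] => //.
        by move=> z [Kz nz]; split; split => // /XY.
      by move=> z [Kz nz]; split; split => // /YX.
    have [|x [Kx xB]] := cK B BF; first by exists X1 => // x [].
    exists x; split=> // X FX; have [_ cX _] := FP _ FX.
    by apply: cX => V xV; apply: xB xV; exists X.
  - by apply: closedI => //; apply: closed_bigI => X /FP[].
have minKX : minimal phi (K `\` X).
  split => // B B0 clB iB BX; apply/seteqP; split => // x [Kx nXx].
  apply: contrapT => nBx.
  have KB : K `\` ~` B = B.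
    rewrite setDE setCK; apply/seteqP; split => [y []|y By] //.
    by have [] := BX _ By.
  apply: (Xmax (~` B)); last by split; rewrite KB.
  split=> [y Xy By|BX']; first by have [] := BX _ By.
  exact/nXx/BX'.
have cKX : compact (K `\` X) by apply: subclosed_compact cK _ => // x [].
by exists (CMin cKX minKX) => x [].
Qed.

Lemma cmin_closed G : closed G.
Proof. exact: compact_closed_set (@cmin_compact _ _ _ G). Qed.

Lemma cmin_invariant G : Defs.invariant phi G.
Proof. by have [] := cmin_minimal G. Qed.

Lemma cmin_eq G A : closed A -> Defs.invariant phi A -> G `&` A !=set0 ->
  A `<=` G -> A = G.
Proof.
move=> cA iA [x [_ Ax]]; have [_ _ _] := cmin_minimal G; apply => //.
by exists x.
Qed.

Lemma cmin_sub_omega G x : G `&` omega phi x !=set0 -> G `<=` omega phi x.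
Proof.
move=> [y [Gy xy]]; rewrite -(@cmin_eq G (G `&` omega phi x)).
- by move=> z [].
- by apply: closedI; [exact: cmin_closed|exact: omega_closed].
- by move=> t z [Gz xz]; split; [exact: cmin_invariant|exact: omega_invariant].
- by exists y.
- by move=> z [].
Qed.

Lemma omega_cmin G x : (G : set M) x -> omega phi x = G.
Proof.
move=> Gx; apply: cmin_eq; [exact: omega_closed|exact: omega_invariant| |].
  have iG : pos_invariant phi G by move=> t y _; exact: cmin_invariant.
  have [y xy] := omega_nonempty (@cmin_compact _ _ _ G) iG Gx.
  exists y; split => //; apply: omega_sub xy => //; first exact: cmin_closed.
  by exists 0; rewrite flow0.
apply: omega_sub; [exact: cmin_closed|move=> t y _; exact: cmin_invariant|].
by exists 0; rewrite flow0.
Qed.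

Lemma cmin_orbit_dense G x : (G : set M) x -> closure (range (phi^~ x)) = G.
Proof.
move=> Gx; apply: cmin_eq.
- exact: closed_closure.
- apply: closure_invariant => s _ [t _ <-].
  by exists (s + t) => //; rewrite flowD.
- by exists x; split => //; apply: subset_closure; exists 0 => //; rewrite flow0.
- have /closure_id -> := @cmin_closed G; apply: closureS => _ [t _ <-].
  exact: cmin_invariant.
Qed.

Lemma cmin_connected G : connected G.
Proof.
have [x Gx] := cmin_nonempty G; rewrite -(cmin_orbit_dense Gx).
apply: connected_closure; apply: connected_continuous_connected.
  by apply/connected_intervalP => a b _ _ c _.
exact/continuous_subspaceT/flow_orbit_continuous.
Qed.

(** An orbit that starts near a point of [G] follows the orbit of that point
    for some time, and the latter is dense in [G]; the neighbourhood can be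
    chosen uniformly because [G] is compact. *)
Lemma cmin_orbit_near G (e : R) : 0 < e ->
  set_nbhs G
    [set x | forall g, (G : set M) g -> exists t, mdist g (phi t x) < e].
Proof.
move=> e0; have e2 : 0 < e / 2 by rewrite divr_gt0.
have /compact_near_coveringP cG := @cmin_compact _ _ _ G.
apply: (cG _ _ (fun x g => exists t, mdist g (phi t x) < e)
  (set_nbhs_filter G)) => g Gg.
exists ([set g' | mdist g g' < e / 2],
        [set x | exists t, mdist g (phi t x) < e / 2]) => /=.
  split; first exact: nbhs_mdist_lt.
  move=> y Gy; move: (Gg); rewrite -(cmin_orbit_dense Gy).
  move=> /closure_mdistP/(_ _ e2)[_ [t _ <-] gt].
  have : nbhs y (phi t @^-1` [set z | mdist g z < e / 2]).
    exact: flow_time_continuous (mdist_lt_nbhs gt).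
  by apply: filterS => x xt; exists t.
move=> [g' x] [/= gg' [t gt]]; exists t; apply: mdist_lt_split gt.
by rewrite metric_sym.
Qed.

(** * Stable minimal sets *)

Lemma stable_trap K V : stable phi K -> set_nbhs K V ->
  exists W, [/\ set_nbhs K W, closed W, pos_invariant phi W & W `<=` V].
Proof.
move=> [_ cK _ sK] /(compact_thickening_sub cK)[e e0 eV].
have e2 : 0 < e / 2 by rewrite divr_gt0.
have [U [KU iU Ue]] := sK _ (set_nbhs_thickening e2).
exists (closure U); split.
- by apply: filterS KU; exact: subset_closure.
- exact: closed_closure.
- exact: closure_pos_invariant.
- by move=> x /(closureS Ue)/(closure_thickening e0)/eV.
Qed.

(** An orbit that accumulates at a point of [G] enters every positively
    invariant neighbourhood of [G], and it is trapped there. *)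
Lemma stable_omega_eq G x : stable phi G -> G `&` omega phi x !=set0 ->
  omega phi x = G.
Proof.
move=> sG Gx; apply/seteqP; split; last exact: cmin_sub_omega.
apply: subset_trans (closed_thickening (@cmin_closed G)) => y xy e e0.
have [W [GW cW iW We]] := stable_trap sG (set_nbhs_thickening e0).
apply/We; apply: omega_sub xy => //.
by have [z [/GW zW /omegaP/(_ 0 _ zW)[t _ Wt]]] := Gx; exists t.
Qed.

Lemma omega_stable_cmin K x : compact K -> pos_invariant phi K ->
  (forall G, G `<=` K -> stable phi G) -> K x ->
  exists2 G : cmin phi, G `<=` K & omega phi x = G.
Proof.
move=> cK iK sK Kx.
have xK : omega phi x `<=` K.
  apply: omega_sub => //; first exact: compact_closed_set.
  by exists 0; rewrite flow0.
have cx : compact (omega phi x).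
  by apply: subclosed_compact cK xK; exact: omega_closed.
have [G Gx] := compact_invariant_cmin cx (@omega_invariant x)
  (omega_nonempty cK iK Kx).
exists G; first exact: subset_trans xK.
have GK := subset_trans Gx xK.
apply: stable_omega_eq; first exact: sK.
by have [z Gz] := cmin_nonempty G; exists z; split=> //; exact: Gx.
Qed.

(** The two halves of the Hausdorff distance have different causes: stability
    puts the limit set near [G], and [cmin_orbit_near], applied to an orbit
    inside the limit set, puts [G] near the limit set. *)
Lemma stable_omega_near G (e : R) : stable phi G -> 0 < e ->
  exists2 W, set_nbhs G W &
    forall x H, W x -> omega phi x = H -> mdist G H < e.
Proof.
move=> sG e0; have e2 : 0 < e / 2 by rewrite divr_gt0.
have [W [GW cW iW WV]] := stable_trap sG
  (filterI (set_nbhs_thickening e2) (cmin_orbit_near e2)).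
exists W => // x H Wx xH.
have HW : H `<=` W.
  by rewrite -xH; apply: omega_sub => //; exists 0; rewrite flow0.
have : hausdorff_dist G H <= e / 2.
  apply: ge_inf; first exact: hausdorff_close_lb.
  split => // [g Gg|h /HW/WV[[g Gg gh] _]]; last by exists g.
  have [h Hh] := cmin_nonempty H; have [_ /(_ _ Gg)[t gt]] := WV _ (HW _ Hh).
  by exists (phi t h) => //; exact: cmin_invariant.
by move=> /le_lt_trans; apply; rewrite ltr_pdivrMr// ltr_pMr// ltr1n.
Qed.

Lemma not_unstable G : ~ unstable phi G -> stable phi G.
Proof. exact: contrapT. Qed.

Lemma hyper_stable_stable G : hyper_stable G -> stable phi G.
Proof.
move=> [N GN Nu]; apply: not_unstable => /Nu GN0.
have [x Gx] := cmin_nonempty G.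
suff : set0 x by [].
by rewrite -GN0; split => //; exact: nbhs_singleton (GN _ Gx).
Qed.

(** Near [G], an unstable minimal set would be close to [G] for the Hausdorff
    metric, because it is the limit set of each of its points. *)
Lemma hyper_stable_notin_closure G :
  ~ closure (unstable phi) G -> hyper_stable G.
Proof.
move=> nG.
have sG : stable phi G by apply: not_unstable => /subset_closure.
have [e e0 eu] : exists2 e, 0 < e &
    forall H, unstable phi H -> ~ mdist G H < e.
  apply: contrapT => ne; apply: nG; apply/closure_mdistP => e e0.
  apply: contrapT => nH; apply: ne; exists e => // H uH GH.
  by apply: nH; exists H.
have [W GW We] := stable_omega_near sG e0.
exists W => // H uH; rewrite -subset0 => x [Hx Wx].
by apply: (eu _ uH); apply: We Wx (omega_cmin Hx).
Qed.

End limit_sets.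

(** Time reversal turns [omega] into the backward limit set; it has the same
    minimal sets. *)
Section reverse_flow.
Context {R : realType} {M : metricType R} (phi : flow M).

Lemma reverse_continuous : continuous (fun p : R * M => phi (- p.1) p.2).
Proof.
move=> p; apply: (@continuous_comp _ _ _ (fun q : R * M => (- q.1, q.2))
  (fun p : R * M => phi p.1 p.2)); last exact: flow_continuous.
have cN : - q.1 @[q --> p] --> - p.1 by apply: cvgN; exact: cvg_fst.
exact: (cvg_pair cN cvg_snd).
Qed.

Let reverse0 x : phi (- 0) x = x. Proof. by rewrite oppr0 flow0. Qed.

Let reverseD s t x : phi (- (s + t)) x = phi (- s) (phi (- t) x).
Proof. by rewrite opprD flowD. Qed.

Definition reverse_flow : flow M :=
  @Flow R M (fun t => phi (- t)) reverse_continuous reverse0 reverseD.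

Lemma invariant_reverse A :
  Defs.invariant reverse_flow A <-> Defs.invariant phi A.
Proof.
by split=> iA t x /(iA (- t)) //=; rewrite opprK.
Qed.

Lemma minimal_reverse A : minimal reverse_flow A -> minimal phi A.
Proof.
move=> [A0 cA /invariant_reverse iA minA]; split => // B B0 cB.
by move=> /invariant_reverse; exact: minA.
Qed.

(** The backward limit set of a complete orbit in [K] contains a minimal set
    [G]. In the past the orbit visits arbitrarily small positively invariant
    neighbourhoods of [G], so [x] lies in all of them, hence in [G]. *)
Lemma complete_orbit_recurrent K x : compact K ->
  (forall G : cmin phi, G `<=` K -> stable phi G) ->
  (forall t, K (phi t x)) -> omega phi x x.
Proof.
move=> cK sK Kx.
have clK := compact_closed_set cK.
pose A := closure (range (phi^~ x)).
have AK : A `<=` K.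
  by rewrite [X in _ `<=` X](closure_id _).1//; apply: closureS => _ [t _ <-].
have cA : compact A by apply: subclosed_compact cK AK; exact: closed_closure.
have iA : Defs.invariant phi A.
  by apply: closure_invariant => s _ [t _ <-]; exists (s + t); rewrite ?flowD.
have Ax : A x by apply: subset_closure; exists 0; rewrite ?flow0.
have iA' : Defs.invariant reverse_flow A by exact/invariant_reverse.
have iA'' : pos_invariant reverse_flow A by move=> t y _; exact: iA'.
have xA : omega reverse_flow x `<=` A.
  apply: omega_sub => //; first exact: closed_closure.
  by exists 0; rewrite flow0.
have cx : compact (omega reverse_flow x).
  by apply: subclosed_compact cA xA; exact: omega_closed.
have [G' G'x] := compact_invariant_cmin cx (@omega_invariant _ _ _ x)
  (omega_nonempty cA iA'' Ax).
pose G := CMin (@cmin_compact _ _ _ G') (minimal_reverse (cmin_minimal G')).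
have sG : stable phi G.
  by apply: sK; apply: subset_trans AK; exact: subset_trans xA.
suff Gx : (G : set M) x by rewrite (omega_cmin Gx).
apply: (closed_thickening (@cmin_closed _ _ _ G)) => e e0.
have [W [GW cW iW We]] := stable_trap sG (set_nbhs_thickening e0).
have [z Gz] := cmin_nonempty G.
have /omegaP/(_ 0 _ (GW _ Gz))[t t0 Wt] := G'x _ Gz.
apply: We; rewrite -(flow0 phi x) -(subrr t) flowD.
exact: iW.
Qed.

End reverse_flow.

(** * Convergence to stable minimal sets *)

Section limit_map.
Context {R : realType} {M : metricType R} (phi : flow M) (L : cmin phi).
Implicit Types (x y : M) (G H : cmin phi).

(** The default value [L] is taken only where the limit set is not a compact
    minimal set. *)
Definition limit_cmin x : cmin phi := xget L [set G | omega phi x = G].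

Lemma limit_cminE x G : omega phi x = G -> limit_cmin x = G.
Proof.
move=> xG; apply: cmin_set_inj; rewrite -xG; symmetry.
exact: (@xgetPex _ L [set G : cmin phi | omega phi x = G] (ex_intro _ G xG)).
Qed.

(** An orbit that converges to [G] is, after a finite time, in the interior of
    the neighbourhood given by [stable_omega_near]; so are the nearby orbits
    after the same time. *)
Lemma limit_cmin_continuous (K : set M) : compact K -> pos_invariant phi K ->
  (forall G, G `<=` K -> stable phi G) -> {within K, continuous limit_cmin}.
Proof.
move=> cK iK sK; apply/subspace_continuousP => x Kx.
have [G GK xG] := omega_stable_cmin cK iK sK Kx.
move=> B xB; have : nbhs (limit_cmin x) B := xB.
rewrite (limit_cminE xG) => /nbhs_mdistP[e e0 eB].
have [W GW We] := stable_omega_near (sK _ GK) e0.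
have [z Gz] := cmin_nonempty G.
have /omegaP/(_ 0 _ (nbhs_interior (GW _ Gz)))[t _ Wt] : omega phi x z.
  by rewrite xG.
suff : nbhs x [set y | K y -> B (limit_cmin y)] by rewrite nbhs_simpl.
have : nbhs x (phi t @^-1` W) by exact: flow_time_continuous.
apply: filterS => y Wy Ky.
have [H _ yH] := omega_stable_cmin cK iK sK Ky.
by rewrite (limit_cminE yH); apply/eB/(We _ _ Wy); rewrite omega_shift.
Qed.

End limit_map.

Section positively_invariant_sets.
Context {R : realType} {M : metricType R} (phi : flow M).
Implicit Types (x : M) (U S : set M) (T t : R).

Lemma backward_exit U x : closed U -> pos_invariant phi U -> U x ->
  ~ (forall t, U (phi t x)) ->
  exists T, [/\ T <= 0, forall t, t < T -> ~ U (phi t x) &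
                forall t, T <= t -> U (phi t x)].
Proof.
move=> cU iU Ux /existsNP[t0 nt0].
have up s t : s <= t -> U (phi s x) -> U (phi t x).
  by move=> st Us; rewrite -(subrK s t) flowD; apply: iU; rewrite ?subr_ge0.
pose E := [set t | U (phi t x)].
have E0 : E 0 by rewrite /E/= flow0.
have lbE : has_lbound E.
  by exists t0 => t Et; rewrite leNgt; apply/negP => /ltW/up/(_ Et).
have gtE t : inf E < t -> U (phi t x).
  move=> Et; have [|s Es st] := @inf_lt _ E t _ Et; first by exists 0.
  exact: up (ltW st) Es.
exists (inf E); split; first exact: ge_inf.
  by move=> t tE Ut; move: tE; rewrite ltNge => /negP; apply; exact: ge_inf.
move=> t; rewrite le_eqVlt => /predU1P[<-|]; last exact: gtE.
apply: cU => B /flow_orbit_continuous/nbhs_ballP[e /= e0 eB].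
exists (phi (inf E + e / 2) x); split.
  by apply: gtE; rewrite ltrDl divr_gt0.
apply: eB; rewrite /ball/= opprD addNKr normrN gtr0_norm ?divr_gt0//.
by rewrite ltr_pdivrMr// ltr_pMr// ltr1n.
Qed.

Definition pos_orbit S : set M :=
  \bigcup_(x in S) [set phi t x | t in [set t | 0 <= t]].

Lemma sub_pos_orbit S : S `<=` pos_orbit S.
Proof. by move=> x Sx; exists x => //; exists 0; rewrite /= ?flow0. Qed.

Lemma pos_orbit_invariant S : pos_invariant phi (pos_orbit S).
Proof.
move=> s _ s0 [x Sx [t /= t0 <-]]; exists x => //; exists (s + t).
  by rewrite /= addr_ge0.
by rewrite flowD.
Qed.

Lemma pos_orbit_sub S U : S `<=` U -> pos_invariant phi U -> pos_orbit S `<=` U.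
Proof. by move=> SU iU _ [x /SU Ux [t /= t0 <-]]; exact: iU. Qed.

Lemma pos_orbit_connected S : connected S -> connected (pos_orbit S).
Proof.
move=> cS; have [[a Sa]|/nonemptyPn S0] := pselect (S !=set0); last first.
  by rewrite /pos_orbit S0 bigcup_set0; exact: connected0.
have -> : pos_orbit S =
    \bigcup_(x in S) (S `|` [set phi t x | t in [set t | 0 <= t]]).
  apply/seteqP; split=> y [x Sx]; first by exists x => //; right.
  by move=> [Sy|xy]; [exact: sub_pos_orbit|exists x].
apply: bigcup_connected; first by exists a => x _; left.
move=> x Sx; apply: connectedU => //.
  by exists x; split => //; exists 0; rewrite /= ?flow0.
apply: connected_continuous_connected.
  apply/connected_intervalP => a' b a0 _ c /andP[ac _].
  exact: le_trans ac.
exact/continuous_subspaceT/flow_orbit_continuous.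
Qed.

(** The limit map is constant along orbits and continuous, so it takes the same
    values on the closed positive orbit of [S] as on [closure S]; and it
    sends the points of a minimal set to that set, so these values are the
    minimal sets in the closed positive orbit. *)
Lemma HS_closure_pos_orbit (L : cmin phi) (W S : set M) :
  compact W -> pos_invariant phi W ->
  (forall G : cmin phi, G `<=` W -> hyper_stable G) -> S `<=` W ->
  HS phi (closure (pos_orbit S)) = limit_cmin L @` closure S.
Proof.
move=> cW iW hW SW; set U := closure _; set pi := limit_cmin L.
have sW (G : cmin phi) : G `<=` W -> stable phi G.
  by move=> /hW/hyper_stable_stable.
have clW := compact_closed_set cW.
have clSW : closure S `<=` W.
  by rewrite [X in _ `<=` X](closure_id _).1//; exact: closureS.
have UW : U `<=` W.
  rewrite [X in _ `<=` X](closure_id _).1//; apply: closureS.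
  exact: pos_orbit_sub.
have iU : pos_invariant phi U.
  exact/closure_pos_invariant/pos_orbit_invariant.
have pic : {within W, continuous pi} by exact: limit_cmin_continuous.
have clX : closed (pi @` closure S).
  apply: compact_closed_set; apply: continuous_compact.
    exact: continuous_subspaceW pic.
  by apply: subclosed_compact cW clSW; exact: closed_closure.
have piU x : U x -> (pi @` closure S) (pi x).
  move=> Ux; apply: clX; apply/closure_mdistP => e e0.
  have [d d0 dpi] := compact_uniform_continuity cW pic e0.
  have /closure_mdistP/(_ d d0)[y Oy xy] := Ux.
  exists (pi y); last by apply: dpi xy; [exact: UW|exact/UW/subset_closure].
  have [s Ss [t _ ty]] := Oy.
  have [G _ sG] := omega_stable_cmin cW iW sW (SW _ Ss).
  exists s; first exact: subset_closure.
  rewrite /pi (limit_cminE _ sG) -ty; symmetry.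
  by apply: limit_cminE; rewrite omega_shift.
apply/seteqP; split=> [G [hG GU]|_ [s Ss <-]].
  have [g Gg] := cmin_nonempty G.
  by rewrite -(limit_cminE L (omega_cmin Gg)); exact/piU/GU.
have [G GW sG] := omega_stable_cmin cW iW sW (clSW _ Ss).
rewrite /pi (limit_cminE _ sG); split; first exact: hW.
rewrite -sG; apply: omega_sub => //; first exact: closed_closure.
by exists 0; rewrite flow0; apply: closureS Ss; exact: sub_pos_orbit.
Qed.

End positively_invariant_sets.

(** * The local trichotomy *)

Theorem theorem2 (R : realType) (M : metricType R)
  (hM : generalized_peano_continuum M) (phi : flow M) (L : cmin phi) :
  [\/ closure (unstable phi) L,
      attractor phi L |
      forall V : set M, set_nbhs L V ->
        exists U : set M,
          [/\ set_nbhs L U, U `<=` V,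
              [/\ compact U, connected U & pos_invariant phi U],
              [/\ forall G : cmin phi, G `<=` U -> hyper_stable G,
                  peano_continuum (HS phi U) &
                  non_degenerate (HS phi U)] &
              forall x : M, U x ->
                (exists2 G : cmin phi, HS phi U G & omega phi x = G) /\
                (~ omega phi x x ->
                 exists T : R,
                   [/\ T <= 0,
                       forall t : R, t < T -> ~ U (phi t x) &
                       forall t : R, T <= t -> U (phi t x)])]].
Proof.
have [clL|nclL] := pselect (closure (unstable phi) L); first by constructor 1.
have [aL|naL] := pselect (attractor phi L); first by constructor 2.
constructor 3 => V LV; have [lcM _ lconM] := hM.
have hL := hyper_stable_notin_closure nclL.
have sL := hyper_stable_stable hL.
have [N LN Nu] := hL.
(* [W] lies in the interior of [N], which makes every minimal set in [W]
   hyper-stable, even those that meet the boundary of [W]. *)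
have [C [cC _ LC]] := locally_compact_set_nbhs lcM (@cmin_compact _ _ _ L).
have [|W [LW clW iW WV]] := @stable_trap _ _ phi L (V `&` (C `&` N°)) sL.
  by apply: filterI LV _; apply: filterI LC _ => x /LN; exact: nbhs_interior.
have cW : compact W by apply: subclosed_compact cC _ => // x /WV[_ []].
have hW (G : cmin phi) : G `<=` W -> hyper_stable G.
  by move=> GW; exists N => // x /GW/WV[_ []].
have [S [LS SW ctS SS]] := property_S_set_nbhs lconM (@cmin_compact _ _ _ L)
  (@cmin_connected _ _ _ L) (cmin_nonempty L) cW LW.
pose U := closure (pos_orbit phi S).
have iU : pos_invariant phi U.
  exact/closure_pos_invariant/pos_orbit_invariant.
have clU : closed U by exact: closed_closure.
have UW : U `<=` W.
  rewrite [X in _ `<=` X](closure_id _).1//; apply: closureS.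
  exact: pos_orbit_sub.
have cU : compact U by exact: subclosed_compact cW UW.
have hU (G : cmin phi) : G `<=` U -> hyper_stable G.
  by move=> GU; apply: hW; exact: subset_trans UW.
have sU (G : cmin phi) : G `<=` U -> stable phi G.
  by move=> /hU/hyper_stable_stable.
have LU : set_nbhs L U.
  have SU : S `<=` U by move=> x Sx; exact/subset_closure/sub_pos_orbit.
  exact: filterS SU LS.
have omegaU x : U x -> exists2 G, HS phi U G & omega phi x = G.
  move=> Ux; have [G GU xG] := omega_stable_cmin cU iU sU Ux.
  by exists G => //; split=> //; exact: hU.
exists U; split => //.
- by move=> x /UW/WV[].
- by split=> //; apply: connected_closure; exact: pos_orbit_connected.
- split => //.
    have clSW : closure S `<=` W.
      by rewrite [X in _ `<=` X](closure_id _).1//; exact: closureS.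
    have cS : compact (closure S).
      by apply: subclosed_compact cW clSW; exact: closed_closure.
    have pic : {within closure S, continuous (limit_cmin L)}.
      apply: continuous_subspaceW clSW _; apply: limit_cmin_continuous => //.
      by move=> G /hW/hyper_stable_stable.
    have cX : compact (limit_cmin L @` closure S).
      exact: continuous_compact.
    rewrite /U (HS_closure_pos_orbit L cW iW hW SW); split => //.
      apply: connected_continuous_connected => //; exact: connected_closure.
    apply: property_S_locally_connected; first exact: compact_closed_set cX.
    by apply: property_S_image => //; exact: property_S_closure.
  (* If [L] is the only minimal set in [U], all points of [U] converge to it. *)
  apply: contrapT => ndU; apply: naL; split => //.
  have HSL : HS phi U L by split => // x Lx; exact: nbhs_singleton (LU _ Lx).
  suff UL : U `<=` [set x | omega phi x !=set0 /\ omega phi x `<=` L].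
    exact: filterS UL LU.
  move=> x /omegaU[G HSG xG].
  rewrite /=; have -> : omega phi x = L.
    rewrite xG; congr cmin_set; apply: contrapT => GL; apply: ndU.
    by exists G, L.
  by split => //; exact: cmin_nonempty.
- move=> x Ux; split; first exact: omegaU.
  move=> nx; apply: backward_exit => // Uall; apply: nx.
  exact: complete_orbit_recurrent cU sU Uall.
Qed.
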